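(* Let $n\ge 3$ and let $u=(u_I)_{I\in\binom{[n]}{2}}$ be a vector of positive integers. Then each (complex) critical point of the log-likelihood function $$L_u(q)=\sum_{I} u_I\log(q_I)-\Big(\sum_I u_I\Big)\log\Big(\sum_I q_I\Big)$$ over $\mathrm{sGr}(2,n)$ is real, positive (i.e. it is represented by homogeneous coordinates $q_I$ that are all positive real numbers), and is a local maximum of $L_u$ restricted to the real points of $\mathrm{sGr}(2,n)$.
   Context: Let $[n]=\{1,\dots,n\}$ and let $\binom{[n]}{2}$ be the set of 2-element subsets of $[n]$. The Grassmannian $\mathrm{Gr}(2,n)\subset \mathbb{P}^{\binom{n}{2}-1}$ (over $\mathbb{C}$) is taken in its Plücker embedding with coordinates $(p_I)_{I\in\binom{[n]}{2}}$. The squared Grassmannian $\mathrm{sGr}(2,n)\subset\mathbb{P}^{\binom{n}{2}-1}$ is the image of $\mathrm{Gr}(2,n)$ under the coordinatewise squaring map $(p_I)_I\mapsto (p_I^2)_I$; write $q_I$ for the coordinates on the target. The log-likelihood function is considered on the open part $\mathrm{sGr}(2,n)^\circ=\{q\in \mathrm{sGr}(2,n) : (\sum_I q_I)\cdot\prod_I q_I\neq 0\}$, which is a smooth variety; $L_u$ is invariant under scaling of $q$ and its differential is a well-defined algebraic 1-form on $\mathrm{sGr}(2,n)^\circ$. The critical points are the points of $\mathrm{sGr}(2,n)^\circ$ where this differential vanishes. *)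

(* Defs.v *)
From HB Require Import structures.
From mathcomp Require Import all_boot all_order all_algebra.
From mathcomp Require Import all_classical all_reals all_analysis.
From mathcomp Require Import complex.
(* The notations of mpoly clash with those of MathComp-Analysis. *)
From mathcomp Require Import -(notations) mpoly.

Set Implicit Arguments.
Unset Strict Implicit.
Unset Printing Implicit Defensive.

Import Order.TTheory GRing.Theory Num.Theory.
Import numFieldNormedType.Exports.

Local Open Scope classical_set_scope.
Local Open Scope ring_scope.

(* The 2-element subset {i, j} of [n] is encoded by the ordered pair (i, j)
   with i < j, which also fixes the sign of the Pluecker coordinate p_{ij}. *)
Definition pairs (n : nat) := {ij : 'I_n * 'I_n | (ij.1 < ij.2)%N}.

(* A point of the projective space with coordinates indexed by [pairs n] is
   handled through its vectors of homogeneous coordinates; [proj_eq x y] says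
   that x and y are homogeneous coordinates of the same point. It is only used
   for nonzero vectors. *)
Definition proj_eq (F : fieldType) (n : nat) (x y : pairs n -> F) : Prop :=
  exists2 c : F, c != 0 & forall I, x I = c * y I.

Definition plucker (F : fieldType) (n : nat) (A : 'M[F]_(2, n)) (I : pairs n) : F :=
  let: (i, j) := val I in A 0 i * A 1 j - A 0 j * A 1 i.

(* A 2-dimensional subspace of F^n is the row space of a rank 2 matrix A. *)
Definition Gr2 (F : fieldType) (n : nat) (p : pairs n -> F) : Prop :=
  exists2 A : 'M[F]_(2, n), \rank A = 2%N & proj_eq p (plucker A).

Definition sGr2 (F : fieldType) (n : nat) (q : pairs n -> F) : Prop :=
  exists2 p : pairs n -> F, Gr2 p & proj_eq q (fun I => p I ^+ 2).

Definition sGr2_open (F : fieldType) (n : nat) (q : pairs n -> F) : Prop :=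
  sGr2 q /\ (\sum_I q I) * (\prod_I q I) != 0.

(* Polynomials in the homogeneous coordinates, the variable of index k being
   the coordinate q_(enum_val k). *)
Definition coord_poly (F : fieldType) (n : nat) := mpoly #|{: pairs n}| F.

Definition eval_poly_at (F : fieldType) (n : nat) (q : pairs n -> F)
    (f : coord_poly F n) : F :=
  meval (fun k => q (enum_val k)) f.

Definition vanishes_on_sGr2 (F : fieldType) (n : nat) (f : coord_poly F n) : Prop :=
  forall q : pairs n -> F, sGr2 q -> eval_poly_at q f = 0.

(* Zariski tangent space at q of the affine cone over sGr(2, n). The tangent
   space of sGr(2, n) at the point [q] is its quotient by the line F q. *)
Definition tangent_sGr2 (F : fieldType) (n : nat) (q v : pairs n -> F) : Prop :=
  forall f : coord_poly F n, vanishes_on_sGr2 f ->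
    \sum_k eval_poly_at q (mderiv k f) * v (enum_val k) = 0.

(* The differential at q of L_u, evaluated at v, with d log f = df / f. It kills
   v = q, so it vanishes on the tangent space of the cone at q if and only if
   the induced form on the tangent space of sGr(2, n) at [q] vanishes. *)
Definition dloglik (F : fieldType) (n : nat) (u : pairs n -> nat)
    (q v : pairs n -> F) : F :=
  \sum_I (u I)%:R * (v I / q I) -
  (\sum_I u I)%N%:R * ((\sum_I v I) / (\sum_I q I)).

Definition critical_point (F : fieldType) (n : nat) (u : pairs n -> nat)
    (q : pairs n -> F) : Prop :=
  sGr2_open q /\ forall v, tangent_sGr2 q v -> dloglik u q v = 0.

Definition loglik (R : realType) (n : nat) (u : pairs n -> nat)
    (q : pairs n -> R) : R :=
  \sum_I (u I)%:R * ln (q I) - (\sum_I u I)%N%:R * ln (\sum_I q I).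

(* A real point belongs to sGr(2, n) when it is the image of a complex point of
   Gr(2, n). *)
Definition real_sGr2 (R : realType) (n : nat) (q : pairs n -> R) : Prop :=
  sGr2 (fun I => (q I)%:C%C).

(* Meant for a real point with positive coordinates: [ln] has junk value 0 on
   nonpositive reals, but the coordinates of nearby points are positive. Since
   [loglik u] is scale invariant and neighbourhoods in the projective space are
   the images of the neighbourhoods of q, this is local maximality at [q]. *)
Definition loglik_local_max (R : realType) (n : nat) (u : pairs n -> nat)
    (q : pairs n -> R) : Prop :=
  real_sGr2 q /\
  \forall x \near (q : {ptws pairs n -> R}), real_sGr2 x -> loglik u x <= loglik u q.

Lemma dloglik_self (F : fieldType) (n : nat) (u : pairs n -> nat) (q : pairs n -> F) :
  (\sum_I q I) * (\prod_I q I) != 0 -> dloglik u q q = 0.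
Proof.
rewrite mulf_eq0 negb_or => /andP[s0 p0]; rewrite /dloglik divff // mulr1 natr_sum.
apply/eqP; rewrite subr_eq0; apply/eqP/eq_bigr => I _.
rewrite divff ?mulr1 //; apply: contra_neq p0 => qI0.
by rewrite (bigD1 I) //= qI0 mul0r.
Qed.

Lemma is_derive_loglik (R : realType) (n : nat) (u : pairs n -> nat)
    (q v : pairs n -> R) : (1 < n)%N -> (forall I, 0 < q I) ->
  is_derive (0 : R) 1 (fun t : R => loglik u (fun I => q I + t * v I)) (dloglik u q v).
Proof.
move=> n1 q0.
have dln (a b : R) : 0 < a ->
    is_derive (0 : R) 1 (fun t : R => ln (a + t * b)) (b / a).
  move=> a0.
  have lin : is_derive (0 : R) 1 (fun t : R => a + t * b) b.
    have -> : (fun t : R => a + t * b) = cst a + b \*: id.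
      by apply/funext => t; rewrite /GRing.add /= /GRing.scale /= [t * b]mulrC.
    by apply: is_derive_eq; rewrite add0r /GRing.scale /= mulr1.
  have a0' : 0 < a + 0 * b by rewrite mul0r addr0.
  apply: is_derive_eq; first exact: (@is_derive1_comp _ _ (fun t => a + t * b) _ _ _ (is_derive1_ln a0') lin).
  by rewrite mul0r addr0 mulrC.
have s0 : 0 < \sum_I q I.
  have I0 : pairs n by exists (Ordinal (ltnW n1), Ordinal n1).
  by rewrite (bigD1 I0) //= ltr_pwDl // sumr_ge0 // => I _; exact: ltW.
have -> : (fun t : R => loglik u (fun I => q I + t * v I)) =
    (\sum_I (u I)%:R \*: (fun t : R => ln (q I + t * v I))) -
    (\sum_I u I)%N%:R \*: (fun t : R => ln (\sum_I q I + t * \sum_I v I)).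
  apply/funext => t; rewrite /loglik big_split/= -mulr_sumr.
  by rewrite [RHS]/GRing.add /= fct_sumE.
apply: is_deriveB; last exact/is_deriveZ/dln.
by elim/big_ind2 : _ => [|*|I _]; [exact: is_derive_cst|exact: is_deriveD|exact/is_deriveZ/dln].
Qed.

(* Main.v *)
Require Import Defs.
From mathcomp Require Import all_boot all_order all_algebra.
From mathcomp Require Import all_classical all_reals all_analysis.
From mathcomp Require Import complex ring lra.
From mathcomp Require Import -(notations) mpoly.

Set Implicit Arguments.
Unset Strict Implicit.
Unset Printing Implicit Defensive.

Import Order.TTheory GRing.Theory Num.Theory.
Import numFieldNormedType.Exports.
Local Open Scope classical_set_scope.
Local Open Scope ring_scope.

(** A point of sGr(2, n) has coordinates [q_ij = c (a_i b_j - a_j b_i)^2], where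
    [a] and [b] are the rows of a 2 x n matrix, and the sum of the coordinates
    is [c] times the Gram determinant of [a] and [b] (Lagrange's identity).
    Moving the columns of the matrix gives tangent vectors, hence equations for
    a critical point. Two families of moves suffice: rescaling the columns
    ([critical_scale]) and moving every column along the Lie algebra of the
    orthogonal group of the Gram form ([critical_rot]).

    Positivity. Over the complex numbers the rows can be chosen isotropic
    ([isotropic_frame]). Rescaling then shows that [a_k b_k] is a fixed multiple
    of the positive integer [m_k], the sum of the [u_I] with [k] in [I]. With
    [z_k = a_k / b_k] the other family reads, for all [phi],
      [sum_(i<j) u_ij (phi_i - phi_j) (z_i + z_j) / (z_i - z_j) = 0].
    Taking [phi_k = |z_k|^2], the real part of the left-hand side is
      [sum_(i<j) u_ij (|z_i|^2 - |z_j|^2)^2 / |z_i - z_j|^2],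
    so all [|z_k|] are equal; the [q_ij] are then proportional to the positive
    numbers [m_i m_j |z_i - z_j|^2] ([critical_positive]).

    Local maximality. A positive real point of sGr(2, n) has a real matrix with
    orthonormal rows, which can be chosen to depend continuously on the point
    ([frame_spec], [cvg_frame0], [cvg_frame1]). In terms of the lengths [rho_k]
    and the angles [theta_k] of its columns, the normalised coordinates are
    [rho_i^2 rho_j^2 sin^2 (theta_j - theta_i)] and the sum of the [rho_k^2] is
    2. The log-likelihood is therefore the sum of a concave function of the
    [rho_k^2], which are subject to this linear constraint, and a function of the
    [theta_k] that is locally concave, as log sin is. Bounding each logarithm by
    its tangent at the critical point ([ln_cross2_le]) leaves linear terms whose
    sum is zero by the critical equations ([loglik_le]). *)

(** * Sums over pairs *)

Definition cross {F : comPzRingType} {n : nat} (a b : 'I_n -> F) (i j : 'I_n) : F :=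
  a i * b j - a j * b i.

Definition dot {F : pzRingType} {n : nat} (a b : 'I_n -> F) : F := \sum_i a i * b i.

(** Splits a sum over ordered pairs into the contributions of the unordered
    ones, so that sums over [pairs n] can be computed index by index. *)
Lemma sum_pairs (V : nmodType) n (f : 'I_n -> 'I_n -> V) :
  (forall i, f i i = 0) ->
  \sum_(I : pairs n) (f (val I).1 (val I).2 + f (val I).2 (val I).1) =
  \sum_i \sum_j f i j.
Proof.
move=> f0; rewrite pair_bigA /= big_split /=.
rewrite (bigID (fun ij : 'I_n * 'I_n => (ij.1 < ij.2)%N)) /=.
have sub (h : 'I_n * 'I_n -> V) :
    \sum_(I : pairs n) h (val I) = \sum_(ij : 'I_n * 'I_n | (ij.1 < ij.2)%N) h ij.
  exact/esym/(big_sub [pred ij : 'I_n * 'I_n | (ij.1 < ij.2)%N] h).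
congr (_ + _); first exact: (sub (fun ij => f ij.1 ij.2)).
rewrite (sub (fun ij => f ij.2 ij.1)).
rewrite [RHS](bigID (fun ij : 'I_n * 'I_n => ij.1 == ij.2)) /=.
rewrite [X in _ = X + _]big1 ?add0r; last by case=> i j /= /andP[_ /eqP ->].
rewrite (reindex_inj (h := fun ij : 'I_n * 'I_n => (ij.2, ij.1))) /=; last first.
  by case=> i j [k l] [-> ->].
by apply: eq_bigl => -[i j] /=; rewrite -leqNgt ltn_neqAle andbC eq_sym.
Qed.

(** * Tangent vectors of the cone over sGr(2, n) *)

(** The field is infinite, as it has characteristic zero. *)
Lemma poly0_all (F : numDomainType) (p : {poly F}) : (forall t, p.[t] = 0) -> p = 0.
Proof.
move=> p0; apply: (@roots_geq_poly_eq0 F p [seq k%:R | k <- iota 0 (size p)]).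
- by apply/allP => t _; rewrite /root p0.
- by rewrite map_inj_uniq ?iota_uniq//; exact: mulrIn.
- by rewrite size_map size_iota.
Qed.

Lemma horner_mmap (F : fieldType) m (h : 'I_m -> {poly F}) (f : mpoly m F) t :
  (mmap polyC h f).[t] = meval (fun k => (h k).[t]) f.
Proof.
rewrite mevalE /mmap horner_sum; apply: eq_bigr => e _.
by rewrite hornerM hornerC horner_prod; under eq_bigr do rewrite horner_exp.
Qed.

(** Chain rule for a polynomial in several variables composed with a polynomial
    curve. Both sides are compatible with sums and obey the Leibniz rule, so it
    is enough to compare them on constants and on variables. *)
Lemma deriv_mmap (F : fieldType) m (h : 'I_m -> {poly F}) (f : mpoly m F) :
  (mmap polyC h f)^`() = \sum_k mmap polyC h (mderiv k f) * (h k)^`().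
Proof.
pose P f := (mmap polyC h f)^`() = \sum_k mmap polyC h (mderiv k f) * (h k)^`().
have P1 : P 1.
  rewrite /P rmorph1 derivC big1// => k _.
  by rewrite -mpolyC1 mderivC raddf0 mul0r.
have PM g1 g2 : P g1 -> P g2 -> P (g1 * g2).
  rewrite /P => e1 e2; rewrite rmorphM derivM e1 e2 mulr_suml mulr_sumr -big_split.
  by apply: eq_bigr => k _; rewrite mderivM rmorphD !rmorphM /=; ring.
have PX i : P (mpolyX F (mnm1 i)).
  rewrite /P mmapX mmap1U (bigD1 i)//= big1 ?addr0 => [|k ki].
    rewrite mderivX mnm1E eqxx scale1r.
    have -> : mnm_sub (mnm1 i) (mnm1 i) = (mnm0 : multinom m).
      by apply/mnmP => j; rewrite mnmBE subnn mnm0E.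
    by rewrite mmapX mmap11 mul1r.
  by rewrite mderivX mnm1E eq_sym (negbTE ki) scale0r raddf0 mul0r.
rewrite -/(P f); elim/mpolyind: f => [|c e p _ _ Pp].
  by rewrite /P raddf0 deriv0 big1// => k _; rewrite !raddf0 mul0r.
have Pe : P (mpolyX F e).
  rewrite mpolyXE_id; elim/big_ind: _ => // i _.
  by elim: (e i) => [|d]; rewrite ?expr0 ?exprS//; exact: PM.
rewrite /P mmapD derivD Pp mmapZ derivM derivC mul0r add0r Pe mulr_sumr -big_split.
by apply: eq_bigr => k _; rewrite mderivD mderivZ mmapD mmapZ mulrDl mulrA.
Qed.

Definition mx2 {F : fieldType} {n} (a b : 'I_n -> F) : 'M[F]_(2, n) :=
  \matrix_(i < 2, j < n) if i == 0 then a j else b j.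

Lemma plucker_mx2 (F : fieldType) n (a b : 'I_n -> F) (I : pairs n) :
  plucker (mx2 a b) I = cross a b (val I).1 (val I).2.
Proof. by rewrite /plucker; case: (val I) => i j; rewrite !mxE. Qed.

Lemma rank_mx2 (F : fieldType) n (a b : 'I_n -> F) i j :
  cross a b i j != 0 -> \rank (mx2 a b) = 2%N.
Proof.
move=> c0; apply/eqP/inj_row_free => v v0.
have E k : v 0 0 * a k + v 0 1 * b k = 0.
  move/matrixP/(_ 0 k): v0; rewrite !mxE !big_ord_recl big_ord0 !mxE/= addr0.
  by rewrite (_ : lift ord0 ord0 = 1)//; exact/val_inj.
have v00 : v 0 0 = 0.
  apply: (mulIf c0); rewrite mul0r /cross.
  transitivity (b j * (v 0 0 * a i + v 0 1 * b i) - b i * (v 0 0 * a j + v 0 1 * b j)).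
    ring.
  by rewrite !E !mulr0 subrr.
have v01 : v 0 1 = 0.
  apply: (mulIf c0); rewrite mul0r /cross.
  transitivity (a i * (v 0 0 * a j + v 0 1 * b j) - a j * (v 0 0 * a i + v 0 1 * b i)).
    ring.
  by rewrite !E !mulr0 subrr.
apply/rowP => -[[|[|//]] kP]; rewrite mxE.
  by rewrite -v00; congr (v 0 _); exact/val_inj.
by rewrite -v01; congr (v 0 _); exact/val_inj.
Qed.

Lemma sGr2_cross (F : fieldType) n (q : pairs n -> F) : sGr2 q ->
  exists c a b, c != 0 /\ forall I, q I = c * cross a b (val I).1 (val I).2 ^+ 2.
Proof.
case=> p [A _ [c1 c10 pE]] [c2 c20 qE].
exists (c2 * c1 ^+ 2), (A 0), (A 1); split; first by rewrite mulf_neq0 ?expf_neq0.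
move=> I; rewrite qE pE /plucker /cross; case: (val I) => i j /=; ring.
Qed.

Lemma cross_sGr2 (F : fieldType) n (q : pairs n -> F) (c : F) (a b : 'I_n -> F) I0 :
  c != 0 -> (forall I, q I = c * cross a b (val I).1 (val I).2 ^+ 2) ->
  q I0 != 0 -> sGr2 q.
Proof.
move=> c0 qE q0; exists (plucker (mx2 a b)).
  exists (mx2 a b); last by exists 1; rewrite ?oner_eq0// => I; rewrite mul1r.
  apply: (@rank_mx2 _ _ a b (val I0).1 (val I0).2).
  by apply: contra_neq q0; rewrite qE => ->; rewrite expr0n mulr0.
by exists c => // I; rewrite plucker_mx2 qE.
Qed.

(** Velocity at [t = 0] of the curve of points coming from the matrices
    [A + t dA]. These matrices have rank 2 for all but finitely many [t], so a
    polynomial vanishing on sGr(2, n) vanishes identically along the curve, and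
    so does its derivative. *)
Lemma tangent_cross (F : numFieldType) n (q : pairs n -> F) (c : F)
    (a b da db : 'I_n -> F) I0 :
  c != 0 -> (forall I, q I = c * cross a b (val I).1 (val I).2 ^+ 2) -> q I0 != 0 ->
  tangent_sGr2 q (fun I => let i := (val I).1 in let j := (val I).2 in
    2 * c * (cross a b i j * (cross da b i j + cross a db i j))).
Proof.
move=> c0 qE q0 f f0.
pose l (x dx : 'I_n -> F) i : {poly F} := (x i)%:P + dx i *: 'X.
have lE x dx i t : (l x dx i).[t] = x i + dx i * t.
  by rewrite /l hornerD hornerC hornerZ hornerX.
pose C i j := cross (l a da) (l b db) i j.
have CE i j t : (C i j).[t] = cross (fun i => a i + da i * t) (fun i => b i + db i * t) i j.
  by rewrite /C /cross hornerD hornerN !hornerM !lE.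
pose h (I : pairs n) := c%:P * C (val I).1 (val I).2 ^+ 2.
have hE I t : (h I).[t] = c *
    cross (fun i => a i + da i * t) (fun i => b i + db i * t) (val I).1 (val I).2 ^+ 2.
  by rewrite /h hornerM hornerC horner_exp CE.
have h0 I : (h I).[0] = q I.
  by rewrite hE qE /cross /= !mulr0 !addr0.
have dl x dx i : (l x dx i)^`() = (dx i)%:P.
  by rewrite /l derivD derivC derivZ derivX add0r alg_polyC.
have dh I : (h I)^`().[0] = 2 * c * (cross a b (val I).1 (val I).2 *
    (cross da b (val I).1 (val I).2 + cross a db (val I).1 (val I).2)).
  rewrite /h derivM derivC mul0r add0r deriv_exp /C /cross derivB !derivM !dl.
  rewrite /= expr1 !(hornerM, hornerMn, hornerD, hornerN, hornerC, hornerZ, hornerX).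
  by rewrite !mulr0 !addr0; ring.
(* The factor [h I0] kills the finitely many [t] at which the rank may drop. *)
have : mmap polyC (h \o enum_val) f * h I0 = 0.
  apply: poly0_all => t; rewrite hornerM horner_mmap.
  have [->|ht] := eqVneq (h I0).[t] 0; first by rewrite mulr0.
  rewrite -[X in X * _]/(eval_poly_at (fun I => (h I).[t]) f) f0 ?mul0r//.
  exact: (@cross_sGr2 _ _ (fun I => (h I).[t]) c _ _ I0 c0 (fun I => hE I t)).
move/eqP; rewrite mulf_eq0 => /orP[|/eqP hI0]; last first.
  by move: q0; rewrite -h0 hI0 horner0 eqxx.
move=> /eqP /(congr1 (fun p => p^`().[0])); rewrite deriv_mmap deriv0 !horner0 horner_sum => e.
rewrite -[RHS]e; apply: eq_bigr => k _; rewrite hornerM horner_mmap dh /=.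
by congr (_ * _); rewrite /eval_poly_at; apply: meval_eq => j; rewrite h0.
Qed.

(** The constant [c] and the factor 2 of the tangent vector cancel: only
    the logarithmic derivatives of the Pluecker coordinates matter. *)
Lemma critical_cross (F : numFieldType) n u (q : pairs n -> F) (c : F) (a b da db : 'I_n -> F) :
  critical_point u q -> (0 < #|{: pairs n}|)%N ->
  c != 0 -> (forall I, q I = c * cross a b (val I).1 (val I).2 ^+ 2) ->
  let p I := cross a b (val I).1 (val I).2 in
  let dp I := cross da b (val I).1 (val I).2 + cross a db (val I).1 (val I).2 in
  \sum_I (u I)%:R * (dp I / p I) =
  (\sum_I u I)%N%:R * (\sum_I p I * dp I) / \sum_I p I ^+ 2.
Proof.
move=> [[_ /[!mulf_eq0] /norP[s0 p0]] crit] /card_gt0P[I0 _] c0 qE p dp.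
have q0 I : q I != 0 by apply: contra_neq p0 => qI; rewrite (bigD1 I)//= qI mul0r.
have pI0 I : p I != 0.
  by apply: contra_neq (q0 I); rewrite qE -/(p I) => ->; rewrite expr0n mulr0.
have sE : \sum_I q I = c * \sum_I p I ^+ 2.
  by rewrite mulr_sumr; apply: eq_bigr => I _; rewrite qE.
have s1 : \sum_I p I ^+ 2 != 0 by apply: contra_neq s0; rewrite sE => ->; rewrite mulr0.
have := crit _ (tangent_cross da db c0 qE (q0 I0)).
rewrite /dloglik => /eqP; rewrite subr_eq0 => /eqP.
have -> : \sum_I (u I)%:R * (2 * c * (p I * dp I) / q I) = 2 * \sum_I (u I)%:R * (dp I / p I).
  rewrite mulr_sumr; apply: eq_bigr => I _; rewrite qE -/(p I); field.
  by rewrite pI0 c0.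
rewrite -mulr_sumr sE => e; apply: (@mulfI _ 2); first by rewrite pnatr_eq0.
rewrite e; field; exact/andP.
Qed.

(** * Critical equations in terms of a matrix *)

Lemma sum_quad (F : comPzRingType) n (a b : 'I_n -> F) k1 k2 k3 :
  \sum_j (k1 * (a j * a j) + k2 * (a j * b j) + k3 * (b j * b j)) =
  k1 * dot a a + k2 * dot a b + k3 * dot b b.
Proof. by rewrite !big_split /= -!mulr_sumr. Qed.

Definition gram {F : comPzRingType} {n} (a b : 'I_n -> F) : F :=
  dot a a * dot b b - dot a b ^+ 2.

(** Up to the factor [gram a b], the form inverse to the Gram matrix, evaluated
    at the columns [i] and [j]. *)
Definition dual_form {F : comPzRingType} {n} (a b : 'I_n -> F) (i j : 'I_n) : F :=
  dot a a * (b i * b j) + dot b b * (a i * a j) - dot a b * (a i * b j + a j * b i).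

(** Lagrange's identity. *)
Lemma sum_cross2 (F : comPzRingType) n (a b : 'I_n -> F) :
  \sum_(I : pairs n) cross a b (val I).1 (val I).2 ^+ 2 = gram a b.
Proof.
pose f i j := a i ^+ 2 * b j ^+ 2 - a i * b i * (a j * b j).
transitivity (\sum_i \sum_j f i j).
  rewrite -sum_pairs => [|i]; last by rewrite /f; ring.
  by apply: eq_bigr => I _; rewrite /f /cross; ring.
transitivity (\sum_i (dot b b * (a i * a i) + - dot a b * (a i * b i) + 0 * (b i * b i))).
  apply: eq_bigr => i _.
  transitivity (\sum_j (0 * (a j * a j) + - (a i * b i) * (a j * b j) + a i ^+ 2 * (b j * b j))).
    by apply: eq_bigr => j _; rewrite /f; ring.
  by rewrite sum_quad; ring.
by rewrite sum_quad /gram; ring.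
Qed.

Lemma sum_cross2_scale (F : comPzRingType) n (a b phi : 'I_n -> F) :
  \sum_(I : pairs n) cross a b (val I).1 (val I).2 ^+ 2 * (phi (val I).1 + phi (val I).2) =
  \sum_i phi i * dual_form a b i i.
Proof.
transitivity (\sum_i \sum_j phi i * cross a b i j ^+ 2).
  rewrite -sum_pairs => [|i]; last by rewrite /cross; ring.
  by apply: eq_bigr => I _; rewrite /cross; ring.
apply: eq_bigr => i _.
transitivity (\sum_j (phi i * b i ^+ 2 * (a j * a j) +
    - (2 * phi i * (a i * b i)) * (a j * b j) + phi i * a i ^+ 2 * (b j * b j))).
  by apply: eq_bigr => j _; rewrite /cross; ring.
by rewrite sum_quad /dual_form; ring.
Qed.

(** The Gram determinant is stationary when the columns move along the Lie
    algebra of the orthogonal group of the Gram form: for each [i], the terms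
    with factor [phi i] add up to zero over [j]. *)
Lemma sum_cross_rot (F : comPzRingType) n (a b phi : 'I_n -> F) :
  \sum_(I : pairs n) cross a b (val I).1 (val I).2 *
     ((phi (val I).2 - phi (val I).1) * dual_form a b (val I).1 (val I).2) = 0.
Proof.
transitivity (\sum_i \sum_j - phi i * (cross a b i j * dual_form a b i j)).
  rewrite -sum_pairs => [|i]; last by rewrite /cross; ring.
  by apply: eq_bigr => I _; rewrite /cross /dual_form; ring.
apply: big1 => i _; rewrite -mulr_sumr.
suff -> : \sum_j cross a b i j * dual_form a b i j = 0 by rewrite mulr0.
transitivity (\sum_j (b i * (dot a b * b i - dot b b * a i) * (a j * a j) +
    (dot b b * a i ^+ 2 - dot a a * b i ^+ 2) * (a j * b j)
    + a i * (dot a a * b i - dot a b * a i) * (b j * b j))).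
  by apply: eq_bigr => j _; rewrite /cross /dual_form; ring.
by rewrite sum_quad; ring.
Qed.

Section Critical.
Context (F : numFieldType) (n : nat) (u : pairs n -> nat) (q : pairs n -> F).
Context (c : F) (a b : 'I_n -> F).
Hypotheses (n2 : (0 < #|{: pairs n}|)%N) (crit : critical_point u q) (c0 : c != 0).
Hypothesis qE : forall I, q I = c * cross a b (val I).1 (val I).2 ^+ 2.

(** The column [k] is moved along itself, with speed [phi k]. *)
Lemma critical_scale phi :
  \sum_I (u I)%:R * (phi (val I).1 + phi (val I).2) =
  (\sum_I u I)%N%:R * (\sum_i phi i * dual_form a b i i) / gram a b.
Proof.
have q0 I : q I != 0.
  case: crit => -[_ /[!mulf_eq0] /norP[_ p0]] _.
  by apply: contra_neq p0 => qI; rewrite (bigD1 I)//= qI mul0r.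
have := critical_cross (fun i => phi i * a i) (fun i => phi i * b i) crit n2 c0 qE.
move=> /= e; rewrite -sum_cross2 -sum_cross2_scale.
transitivity (\sum_I (u I)%:R * ((cross (fun i => phi i * a i) b (val I).1 (val I).2 +
   cross a (fun i => phi i * b i) (val I).1 (val I).2) / cross a b (val I).1 (val I).2)).
  apply: eq_bigr => I _; congr (_ * _); apply: (canRL (mulfK _)).
    by apply: contra_neq (q0 I); rewrite qE => ->; rewrite expr0n mulr0.
  by rewrite /cross; ring.
rewrite e; congr (_ * _ / _); apply: eq_bigr => I _; rewrite /cross; ring.
Qed.

(** The column [k] is moved by [phi k] times a generator of the orthogonal
    Lie algebra of the Gram form. That generator is skew with respect to the
    determinant pairing, so [p_ij] moves by [phi j - phi i] times the value of
    the symmetric form [dual_form]; by [sum_cross_rot] the total is stationary. *)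
Lemma critical_rot phi :
  \sum_I (u I)%:R * ((phi (val I).2 - phi (val I).1) *
     dual_form a b (val I).1 (val I).2 / cross a b (val I).1 (val I).2) = 0.
Proof.
pose da i := phi i * (dot a b * a i - dot a a * b i).
pose db i := phi i * (dot b b * a i - dot a b * b i).
have dp i j : cross da b i j + cross a db i j = (phi j - phi i) * dual_form a b i j.
  by rewrite /cross /da /db /dual_form; ring.
have := critical_cross da db crit n2 c0 qE; move=> /= e.
under eq_bigr do rewrite -dp.
rewrite e; under [X in _ * X / _]eq_bigr do rewrite dp.
by rewrite sum_cross_rot mulr0 mul0r.
Qed.

End Critical.

(** A nondegenerate binary quadratic form over an algebraically closed field is
    a product of two independent linear forms; a change of basis of the row space
    multiplies all the Pluecker coordinates by the same determinant. *)
Lemma isotropic_frame (C : numClosedFieldType) n (q : pairs n -> C) (c : C) (a b : 'I_n -> C) :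
  c != 0 -> (forall I, q I = c * cross a b (val I).1 (val I).2 ^+ 2) -> gram a b != 0 ->
  exists c' a' b', [/\ c' != 0,
    forall I, q I = c' * cross a' b' (val I).1 (val I).2 ^+ 2, dot a' a' = 0 & dot b' b' = 0].
Proof.
move=> c0 qE D0.
have base x y z w : x * w - y * z != 0 ->
    x ^+ 2 * dot a a + 2 * x * y * dot a b + y ^+ 2 * dot b b = 0 ->
    z ^+ 2 * dot a a + 2 * z * w * dot a b + w ^+ 2 * dot b b = 0 ->
  exists c' a' b', [/\ c' != 0,
    forall I, q I = c' * cross a' b' (val I).1 (val I).2 ^+ 2, dot a' a' = 0 & dot b' b' = 0].
  move=> d0 xy zw.
  exists (c / (x * w - y * z) ^+ 2), (fun i => x * a i + y * b i), (fun i => z * a i + w * b i).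
  have sq s t : dot (fun i => s * a i + t * b i) (fun i => s * a i + t * b i) =
      s ^+ 2 * dot a a + 2 * s * t * dot a b + t ^+ 2 * dot b b.
    by rewrite -sum_quad; apply: eq_bigr => i _; ring.
  split; rewrite ?sq//; first by rewrite mulf_neq0// invr_neq0// expf_neq0.
  move=> I; rewrite qE /cross; field; exact: d0.
have [aa0|aa0] := eqVneq (dot a a) 0.
  have ab0 : dot a b != 0 by apply: contra_neq D0 => ab0; rewrite /gram aa0 ab0; ring.
  apply: (base 1 0 (- (dot b b / (2 * dot a b))) 1); rewrite ?aa0.
  - by rewrite mulr1 mul0r subr0 oner_eq0.
  - by ring.
  - by field; rewrite ab0.
(* [x a + (a.a) b] is isotropic when [x] is one of [- a.b + s] and [- a.b - s],
   where [s] is a square root of the discriminant. *)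
pose s := sqrtC (- gram a b).
have s2 : s ^+ 2 = - gram a b by rewrite sqrtCK.
have s0 : s != 0 by apply: contra_neq D0 => s0; apply/eqP; rewrite -oppr_eq0 -s2 s0 expr0n.
have root t : t ^+ 2 = - gram a b -> (- dot a b + t) ^+ 2 * dot a a +
    2 * (- dot a b + t) * dot a a * dot a b + dot a a ^+ 2 * dot b b = 0.
  move=> t2; transitivity (dot a a * (t ^+ 2 + gram a b)); first by rewrite /gram; ring.
  by rewrite t2 addNr mulr0.
apply: (base (- dot a b + s) (dot a a) (- dot a b - s) (dot a a)).
- have -> : (- dot a b + s) * dot a a - dot a a * (- dot a b - s) = 2 * dot a a * s by ring.
  by rewrite !mulf_neq0// pnatr_eq0.
- exact: root.
- by apply: root; rewrite sqrrN.
Qed.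

(** * Complex critical points are real and positive *)

Lemma pair_of n (i j : 'I_n) : i != j -> exists I : pairs n, val I = (i, j) \/ val I = (j, i).
Proof.
rewrite -val_eqE neq_ltn => /orP[] lt; first by exists (exist _ (i, j) lt); left.
by exists (exist _ (j, i) lt); right.
Qed.

(** The degree of the vertex [k] in the complete graph with edge
    multiplicities [u]. *)
Definition degree {n} (u : pairs n -> nat) (k : 'I_n) : nat :=
  \sum_I u I * (((val I).1 == k) + ((val I).2 == k)).

Lemma degree_gt0 n (u : pairs n -> nat) k :
  (1 < n)%N -> (forall I, (0 < u I)%N) -> (0 < degree u k)%N.
Proof.
move=> n1 u0; have [j kj] : exists j, k != j.
  have [->|] := eqVneq k (Ordinal n1); last by exists (Ordinal n1).
  by exists (Ordinal (ltnW n1)).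
have [I Ik] := pair_of kj.
rewrite /degree (bigD1 I)//= addn_gt0 muln_gt0 u0 /=.
by case: Ik => ->; rewrite /= eqxx ?addn1.
Qed.

Lemma natr_degree (F : pzRingType) n (u : pairs n -> nat) k :
  (degree u k)%:R = \sum_I (u I)%:R * (((val I).1 == k)%:R + ((val I).2 == k)%:R) :> F.
Proof. by rewrite natr_sum; apply: eq_bigr => I _; rewrite natrM natrD. Qed.

(** Twice the real part of [(z + w) / (z - w)] has the sign of
    [|z|^2 - |w|^2]; this is what makes all the terms of the critical equation
    nonnegative in the proof of [critical_positive]. *)
Lemma add_conj_cayley (C : numClosedFieldType) (z w : C) : z != w ->
  (z + w) / (z - w) + ((z + w) / (z - w))^* =
  2 * (`|z| ^+ 2 - `|w| ^+ 2) / `|z - w| ^+ 2.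
Proof.
move=> zw; rewrite !normCK fmorph_div !rmorphD !rmorphN /=.
have zw0 : z - w != 0 by rewrite subr_eq0.
have : z^* - w^* != 0 by rewrite -rmorphB fmorph_eq0.
move: (z^*) (w^*) => z' w' zw'; field.
by rewrite zw0 zw'.
Qed.

(** In the isotropic frame the rescaling equations determine the products
    [a_k b_k], and the rotation equations with [phi_k = |z_k|^2] put all the
    ratios [z_k = a_k / b_k] on one circle [|z|^2 = rho]. There
    [z^* = rho / z], so [(z_i - z_j)^2 / (z_i z_j) = - |z_i - z_j|^2 / rho]. *)
Lemma critical_positive (C : numClosedFieldType) n (u : pairs n -> nat) (q : pairs n -> C) :
  (1 < n)%N -> (forall I, (0 < u I)%N) -> critical_point u q ->
  exists c, exists z : 'I_n -> C, [/\ c != 0, forall I : pairs n, z (val I).1 != z (val I).2 &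
   forall I, q I = c * ((degree u (val I).1 * degree u (val I).2)%:R *
     `|z (val I).1 - z (val I).2| ^+ 2)].
Proof.
move=> n1 u0 crit.
have n2 : (0 < #|{: pairs n}|)%N.
  by apply/card_gt0P; exists (exist _ (Ordinal (ltnW n1), Ordinal n1) (ltnSn 0)).
have [/sGr2_cross[c1 [a1 [b1 [c10 qE1]]]]] := crit.1.
rewrite mulf_eq0 => /norP[s0 p0].
have q0 I : q I != 0 by apply: contra_neq p0 => qI; rewrite (bigD1 I)//= qI mul0r.
have gram0 c a b : (forall I, q I = c * cross a b (val I).1 (val I).2 ^+ 2) -> gram a b != 0.
  move=> qE; apply: contra_neq s0; rewrite -sum_cross2 => g0.
  by under eq_bigr do rewrite qE; rewrite -mulr_sumr g0 mulr0.
have [c [a [b [c0 qE aa bb]]]] := isotropic_frame c10 qE1 (gram0 _ _ _ qE1).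
have {gram0} := gram0 _ _ _ qE.
set ab := dot a b; have -> : gram a b = - ab ^+ 2 by rewrite /gram aa mul0r sub0r.
rewrite oppr_eq0 sqrf_eq0 => ab0.
have form i j : dual_form a b i j = - ab * (a i * b j + a j * b i).
  by rewrite /dual_form aa bb -/ab; ring.
have gramE : gram a b = - ab ^+ 2 by rewrite /gram aa mul0r sub0r.
set U := (\sum_I u I)%N%:R : C.
have U0 : U != 0.
  rewrite pnatr_eq0 -lt0n; have /card_gt0P[I _] := n2.
  by rewrite (bigD1 I)//= addn_gt0 u0.
have deg k : (degree u k)%:R = 2 * U * (a k * b k) / ab :> C.
  rewrite natr_degree (critical_scale n2 crit c0 qE (fun i => (i == k)%:R)) gramE.
  have -> : \sum_i (i == k)%:R * dual_form a b i i = dual_form a b k k.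
    by rewrite (bigD1 k)//= eqxx mul1r big1 ?addr0 // => i /negbTE->; rewrite mul0r.
  by rewrite form -/U; field; rewrite ab0.
have d0 k : (degree u k)%:R != 0 :> C by rewrite pnatr_eq0 -lt0n degree_gt0.
have a0 k : a k != 0.
  by apply: contra_neq (d0 k) => ak; rewrite deg ak; ring.
have b0 k : b k != 0.
  by apply: contra_neq (d0 k) => bk; rewrite deg bk; ring.
pose z k := a k / b k.
have z0 k : z k != 0 by rewrite mulf_neq0 ?invr_neq0.
have formz i j : a i * b j + a j * b i = b i * b j * (z i + z j).
  by rewrite /z; field; rewrite !b0.
have crossz i j : cross a b i j = b i * b j * (z i - z j).
  by rewrite /cross /z; field; rewrite !b0.
have zz (I : pairs n) : z (val I).1 != z (val I).2.
  apply: contra_neq (q0 I) => e; rewrite qE crossz e; ring.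
have Neq (I : pairs n) : `|z (val I).1| ^+ 2 = `|z (val I).2| ^+ 2.
  (* The real part of the rotation equation for [phi = N] is a sum of nonnegative
     terms, so each of them is zero. *)
  pose N i := `|z i| ^+ 2.
  pose T I := (u I)%:R * ((N (val I).2 - N (val I).1) *
     ((z (val I).1 + z (val I).2) / (z (val I).1 - z (val I).2))).
  have T0 : \sum_I T I = 0.
    apply: (mulfI (x := - ab)); rewrite ?oppr_eq0// mulr0.
    rewrite -[RHS](critical_rot n2 crit c0 qE N) mulr_sumr; apply: eq_bigr => J _.
    rewrite /T form formz crossz; move: (zz J) (b0 (val J).1) (b0 (val J).2).
    rewrite -subr_eq0; move: (z _) (z _) (b _) (b _) => zi zj bi bj zij bi0 bj0.
    by field; rewrite zij bi0 bj0.
  have TN J : T J + (T J)^* = - ((u J)%:R * (2 * (N (val J).1 - N (val J).2) ^+ 2 /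
      `|z (val J).1 - z (val J).2| ^+ 2)).
    have NR i : (N i)^* = N i by rewrite /N normCK rmorphM /= conjCK mulrC.
    rewrite /T rmorphM /= conjC_nat rmorphM rmorphB /= !NR -!mulrDr (add_conj_cayley (zz J)).
    by rewrite -/(N _) -/(N _); ring.
  have : \sum_J (u J)%:R * (2 * (N (val J).1 - N (val J).2) ^+ 2 /
      `|z (val J).1 - z (val J).2| ^+ 2) = 0.
    apply: oppr_inj; rewrite oppr0 -sumrN.
    rewrite (eq_bigr (fun J => T J + (T J)^*)) => [|J _]; last by rewrite TN.
    by rewrite big_split /= -rmorph_sum T0 rmorph0 addr0.
  have nr (J : pairs n) : `|z (val J).1 - z (val J).2| ^+ 2 > 0.
    by rewrite exprn_gt0// normr_gt0 subr_eq0 zz.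
  have T_ge0 J : true -> 0 <= (u J)%:R * (2 * (N (val J).1 - N (val J).2) ^+ 2 /
      `|z (val J).1 - z (val J).2| ^+ 2).
    move=> _; apply: mulr_ge0 => //; apply: divr_ge0; last exact: ltW.
    by apply: mulr_ge0 => //; rewrite real_exprn_even_ge0// rpredB// ger0_real// exprn_ge0.
  move/(psumr_eq0P T_ge0)/(_ I isT)/eqP; rewrite !mulf_eq0.
  rewrite pnatr_eq0 eqn0Ngt u0 /= pnatr_eq0 /= orbb invr_eq0 (gt_eqF (nr I)) orbF.
  by rewrite subr_eq0 => /eqP.
have [k0 _] : exists k : 'I_n, True by exists (Ordinal n1).
pose rho := `|z k0| ^+ 2.
have rho0 : rho != 0 by rewrite expf_neq0// normr_eq0.
have rhoE k : `|z k| ^+ 2 = rho.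
  have [->//|/pair_of[J Jk]] := eqVneq k k0.
  by case: Jk (Neq J) => -> /=.
exists (- c * (ab / (2 * U)) ^+ 2 / rho), z; split => // [|I].
  rewrite mulf_neq0 ?invr_neq0// mulf_neq0 ?oppr_eq0// expf_neq0// mulf_neq0//.
  by rewrite invr_neq0// mulf_neq0// pnatr_eq0.
have conjz k : (z k)^* = rho / z k by rewrite -(rhoE k) normCK; field.
rewrite natrM !deg normCK rmorphB /= !conjz qE crossz /z.
move: (b0 (val I).1) (b0 (val I).2) (a0 (val I).1) (a0 (val I).2).
move: (a _) (a _) (b _) (b _) => ai aj bi bj bi0 bj0 ai0 aj0.
by field; rewrite ab0 U0 rho0 bi0 bj0 ai0 aj0.
Qed.

(** * Gram-Schmidt orthonormalisation *)

Section GramSchmidt.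
Context (R : rcfType) (n : nat).
Implicit Types a b : 'I_n -> R.

Definition gs0 a (k : 'I_n) : R := a k / Num.sqrt (dot a a).

Definition gs1 a b (k : 'I_n) : R :=
  (dot a a * b k - dot a b * a k) / Num.sqrt (dot a a * gram a b).

Lemma gs_spec a b : 0 < dot a a -> 0 < gram a b ->
  [/\ dot (gs0 a) (gs0 a) = 1, dot (gs0 a) (gs1 a b) = 0, dot (gs1 a b) (gs1 a b) = 1 &
    forall i j, cross (gs0 a) (gs1 a b) i j ^+ 2 = cross a b i j ^+ 2 / gram a b].
Proof.
move=> aa0 g0; have ag0 : 0 < dot a a * gram a b by rewrite mulr_gt0.
have s2 : Num.sqrt (dot a a) ^+ 2 = dot a a by rewrite sqr_sqrtr ?ltW.
have t2 : Num.sqrt (dot a a * gram a b) ^+ 2 = dot a a * gram a b by rewrite sqr_sqrtr ?ltW.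
have : Num.sqrt (dot a a * gram a b) != 0 by rewrite gt_eqF ?sqrtr_gt0.
have : Num.sqrt (dot a a) != 0 by rewrite gt_eqF ?sqrtr_gt0.
have aa1 : dot a a != 0 by rewrite gt_eqF.
have g1 : gram a b != 0 by rewrite gt_eqF.
rewrite /gs0 /gs1; move: (Num.sqrt (dot a a)) (Num.sqrt (dot a a * _)) s2 t2 => s t s2 t2 s0 t0.
split.
- transitivity (\sum_j (s ^- 2 * (a j * a j) + 0 * (a j * b j) + 0 * (b j * b j))).
    by apply: eq_bigr => j _; field.
  by rewrite sum_quad s2; field.
- transitivity (\sum_j (- dot a b / (s * t) * (a j * a j) +
     dot a a / (s * t) * (a j * b j) + 0 * (b j * b j))).
    by apply: eq_bigr => j _; field; rewrite s0 t0.
  by rewrite sum_quad; field; rewrite s0 t0.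
- transitivity (\sum_j (dot a b ^+ 2 / t ^+ 2 * (a j * a j) +
     - (2 * dot a a * dot a b) / t ^+ 2 * (a j * b j) + dot a a ^+ 2 / t ^+ 2 * (b j * b j))).
    by apply: eq_bigr => j _; field.
  rewrite sum_quad; transitivity (dot a a * gram a b / t ^+ 2); first by rewrite /gram; field.
  by rewrite t2 divff// mulf_neq0.
- move=> i j; transitivity (dot a a ^+ 2 * cross a b i j ^+ 2 / (s ^+ 2 * t ^+ 2)).
    by rewrite /cross; field; rewrite s0 t0.
  by rewrite s2 t2; field; rewrite aa1 g1.
Qed.
End GramSchmidt.

(** * Coordinates indexed by ordered pairs *)

(** Coordinates as a symmetric function of two indices, with zero diagonal. *)
Definition sym_ext {F : zmodType} {n} (x : pairs n -> F) (i j : 'I_n) : F :=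
  if (insub (i, j) : option (pairs n)) is Some J then x J
  else if (insub (j, i) : option (pairs n)) is Some J then x J else 0.

Lemma sym_extE (F : zmodType) n (x : pairs n -> F) (f : 'I_n -> 'I_n -> F) :
  (forall i, f i i = 0) -> (forall i j, f i j = f j i) ->
  (forall I, x I = f (val I).1 (val I).2) -> forall i j, sym_ext x i j = f i j.
Proof.
move=> f0 fC xE i j; rewrite /sym_ext.
case: insubP => [I _ Iij|]; first by rewrite xE Iij.
case: insubP => [I _ Iji|]; first by rewrite xE Iji fC.
rewrite /= -!leqNgt => ij ji; have -> : i = j by apply/val_inj/eqP; rewrite eqn_leq ij.
by rewrite f0.
Qed.

Lemma sym_ext_gt0 (R : numDomainType) n (x : pairs n -> R) i j :
  (forall I, 0 < x I) -> i != j -> 0 < sym_ext x i j.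
Proof.
move=> x0 ij; rewrite /sym_ext; case: insubP => [I _ _//|]; case: insubP => [I _ _//|].
rewrite /= -!leqNgt => /[swap] + /[dup]; move: ij.
by rewrite -val_eqE neq_ltn !ltnNge => /orP[]/negP.
Qed.

Lemma sym_extxx (F : zmodType) n (x : pairs n -> F) i : sym_ext x i i = 0.
Proof. by rewrite /sym_ext insubF//= ltnn. Qed.

Lemma sym_extC (F : zmodType) n (x : pairs n -> F) i j : sym_ext x i j = sym_ext x j i.
Proof.
rewrite /sym_ext; case: insubP => [I ij Iij|]; case: insubP => [J ji Jji|] //.
by move: ij ji => /= /ltnW; rewrite leqNgt => /negP.
Qed.

Lemma sym_ext_val (F : zmodType) n (x : pairs n -> F) (I : pairs n) :
  sym_ext x (val I).1 (val I).2 = x I.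
Proof. by rewrite /sym_ext -surjective_pairing valK. Qed.

(** * Orthonormal frames of real points *)

Section Frame.
Context (R : realType) (n : nat) (o0 o1 o2 : 'I_n).
Hypotheses (o01 : o0 != o1) (o02 : o0 != o2) (o12 : o1 != o2).

(** If [x] consists of the squares of the Pluecker coordinates [p] of a matrix,
    and 0, 1, 2 stand for [o0], [o1], [o2], then [polar x k] is
    [p_02 p_12 p_0k p_1k], obtained from the three-term Pluecker relation
    [p_01 p_2k = p_02 p_1k - p_0k p_12] by squaring. It carries the information
    on signs that the squares forget. *)
Definition polar (x : pairs n -> R) k : R :=
  (sym_ext x o0 o2 * sym_ext x o1 k + sym_ext x o0 k * sym_ext x o1 o2 -
   sym_ext x o0 o1 * sym_ext x o2 k) / 2.

(** For a real matrix, in the basis of the row space where the column [k] is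
    [(p_0k, p_1k)], the rows [row0] and [row1] are obtained by flipping the sign
    of each column so that its first entry is nonnegative, and possibly that of
    [row1]. The column [o0], whose first entry is zero, is treated apart. These
    expressions depend on [x] only, and continuously. *)
Definition row0 (x : pairs n -> R) k : R :=
  if k == o0 then 0 else Num.sqrt (sym_ext x o0 k).

Definition row1 (x : pairs n -> R) k : R :=
  if k == o0 then Num.sqrt (sym_ext x o0 o1) else
  polar x k / (Num.sqrt (sym_ext x o0 o2 * sym_ext x o1 o2) * Num.sqrt (sym_ext x o0 k)).

(** [p_01 p_jk = p_0j p_1k - p_0k p_1j], multiplied by [p_02 p_12 p_0j p_0k]
    and squared. The matrix behind a real point may be complex, so the
    identity is checked there. *)
Lemma polar_id (x : pairs n -> R) j k : real_sGr2 x ->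
  (sym_ext x o0 j * polar x k - sym_ext x o0 k * polar x j) ^+ 2 =
  sym_ext x o0 o1 * sym_ext x j k * (sym_ext x o0 o2 * sym_ext x o1 o2) *
    (sym_ext x o0 j * sym_ext x o0 k).
Proof.
move=> /sGr2_cross[c [a [b [c0 qE]]]]; apply: complexI.
have sE i l : (sym_ext x i l)%:C%C = c * cross a b i l ^+ 2.
  rewrite -(@sym_extE _ _ (fun I => (x I)%:C%C) (fun i l => c * cross a b i l ^+ 2)) //.
  - by rewrite /sym_ext; case: insubP => // _; case: insubP.
  - by move=> ?; rewrite /cross; ring.
  - by move=> ? ?; rewrite /cross; ring.
have plu i l : cross a b o0 o1 * cross a b i l =
   cross a b o0 i * cross a b o1 l - cross a b o0 l * cross a b o1 i.
  by rewrite /cross; ring.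
have pE i : (polar x i)%:C%C = c ^+ 2 *
    (cross a b o0 o2 * cross a b o0 i * cross a b o1 o2 * cross a b o1 i).
  rewrite /polar rmorphM fmorphV rmorphB rmorphD !rmorphM /= !sE rmorph_nat.
  have -> : c * cross a b o0 o1 ^+ 2 * (c * cross a b o2 i ^+ 2) =
     c ^+ 2 * (cross a b o0 o1 * cross a b o2 i) ^+ 2 by ring.
  by rewrite plu; field.
move: (polar x j) (polar x k) (pE j) (pE k) => mj mk mjE mkE.
rewrite rmorphXn rmorphB !rmorphM /= !mjE !mkE !sE.
have -> : forall t, c * cross a b o0 o1 ^+ 2 * (c * cross a b j k ^+ 2) * t =
   c ^+ 2 * (cross a b o0 o1 * cross a b j k) ^+ 2 * t by move=> t; ring.
by rewrite plu; ring.
Qed.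

Lemma row_cross (x : pairs n -> R) j k : (forall I, 0 < x I) -> real_sGr2 x ->
  cross (row0 x) (row1 x) j k ^+ 2 = sym_ext x o0 o1 * sym_ext x j k.
Proof.
move=> x0 xG.
have s0 i l : i != l -> 0 < sym_ext x i l by exact: sym_ext_gt0.
rewrite /cross /row0 /row1; case: (eqVneq j o0) => [->|jo]; case: (eqVneq k o0) => [->|ko].
- by rewrite sym_extxx; ring.
- rewrite mul0r sub0r sqrrN exprMn !sqr_sqrtr ?ltW ?s0// 1?eq_sym//; ring.
- rewrite mul0r subr0 exprMn !sqr_sqrtr ?ltW ?s0// 1?eq_sym//.
  by rewrite [sym_ext x j o0]sym_extC; ring.
have s0j : 0 < sym_ext x o0 j by rewrite s0// eq_sym.
have s0k : 0 < sym_ext x o0 k by rewrite s0// eq_sym.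
set W := sym_ext x o0 o2 * _; have W0 : 0 < W by rewrite mulr_gt0 ?s0.
set sj := Num.sqrt (sym_ext x o0 j); set sk := Num.sqrt (sym_ext x o0 k).
have sj2 : sj ^+ 2 = sym_ext x o0 j by rewrite sqr_sqrtr ?ltW.
have sk2 : sk ^+ 2 = sym_ext x o0 k by rewrite sqr_sqrtr ?ltW.
have sj0 : sj != 0 by rewrite gt_eqF ?sqrtr_gt0.
have sk0 : sk != 0 by rewrite gt_eqF ?sqrtr_gt0.
have: Num.sqrt W ^+ 2 = W by rewrite sqr_sqrtr ?ltW.
have : Num.sqrt W != 0 by rewrite gt_eqF ?sqrtr_gt0.
move: (Num.sqrt W) => w w0 w2.
have -> : sj * (polar x k / (w * sk)) - sk * (polar x j / (w * sj)) =
    (sym_ext x o0 j * polar x k - sym_ext x o0 k * polar x j) / (w * sj * sk).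
  by rewrite -sj2 -sk2; field; rewrite w0 sj0 sk0.
rewrite expr_div_n polar_id// -/W -sj2 -sk2 -w2; field.
by rewrite sj0 sk0 w0.
Qed.

Definition frame0 (x : pairs n -> R) : 'I_n -> R := gs0 (row0 x).

Definition frame1 (x : pairs n -> R) : 'I_n -> R := gs1 (row0 x) (row1 x).

Section Point.
Variable x : pairs n -> R.
Hypotheses (x0 : forall I, 0 < x I) (xG : real_sGr2 x).

Lemma sum_coord_gt0 : 0 < \sum_I x I.
Proof.
have [I _] := pair_of o01.
by rewrite (bigD1 I)//= ltr_pwDl// sumr_ge0// => J _; exact: ltW.
Qed.

Lemma gram_row : gram (row0 x) (row1 x) = sym_ext x o0 o1 * \sum_I x I.
Proof.
rewrite -sum_cross2 mulr_sumr; apply: eq_bigr => I _.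
by rewrite row_cross// sym_ext_val.
Qed.

Lemma gram_row_gt0 : 0 < gram (row0 x) (row1 x).
Proof. by rewrite gram_row mulr_gt0 ?sum_coord_gt0 ?sym_ext_gt0. Qed.

Lemma dot_row0_gt0 : 0 < dot (row0 x) (row0 x).
Proof.
rewrite /dot (bigD1 o1)//= ltr_pwDl//; last first.
  by apply: sumr_ge0 => i _; rewrite -expr2 sqr_ge0.
rewrite -expr2 exprn_gt0// /row0 eq_sym (negbTE o01) sqrtr_gt0.
exact: sym_ext_gt0.
Qed.

Lemma frame_spec : [/\ dot (frame0 x) (frame0 x) = 1, dot (frame0 x) (frame1 x) = 0,
  dot (frame1 x) (frame1 x) = 1 &
  forall I, x I / (\sum_J x J) = cross (frame0 x) (frame1 x) (val I).1 (val I).2 ^+ 2].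
Proof.
have aa0 := dot_row0_gt0; have g0 := gram_row_gt0.
have [-> -> -> cE] := gs_spec aa0 g0; split=> // I.
rewrite cE row_cross// sym_ext_val gram_row; field.
by rewrite !gt_eqF ?sum_coord_gt0 ?sym_ext_gt0.
Qed.
End Point.
End Frame.

(** * Continuity of the frames *)

Section Continuity.
Context (R : realType) (n : nat) (T : Type) (F : set_system T) (FF : Filter F).

Lemma cvg_dot (a b : T -> 'I_n -> R) (la lb : 'I_n -> R) :
  (forall i, a x i @[x --> F] --> la i) -> (forall i, b x i @[x --> F] --> lb i) ->
  dot (a x) (b x) @[x --> F] --> dot la lb.
Proof.
move=> ha hb; apply: cvg_big => [|i _]; last exact: cvgM.
exact: add_continuous.
Qed.

Lemma cvg_gram (a b : T -> 'I_n -> R) (la lb : 'I_n -> R) :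
  (forall i, a x i @[x --> F] --> la i) -> (forall i, b x i @[x --> F] --> lb i) ->
  gram (a x) (b x) @[x --> F] --> gram la lb.
Proof.
move=> ha hb; apply: cvgB; first by apply: cvgM; exact: cvg_dot.
by rewrite expr2; under eq_fun do rewrite expr2; apply: cvgM; exact: cvg_dot.
Qed.

Lemma cvg_div (f g : T -> R) (lf lg : R) : lg != 0 ->
  f x @[x --> F] --> lf -> g x @[x --> F] --> lg -> f x / g x @[x --> F] --> lf / lg.
Proof. by move=> g0 hf hg; apply: cvgM => //; exact: cvgV. Qed.

Lemma cvg_sqrt (f : T -> R) (l : R) :
  f x @[x --> F] --> l -> Num.sqrt (f x) @[x --> F] --> Num.sqrt l.
Proof. by move=> hf; exact: (cvg_comp _ _ hf (@sqrt_continuous R l)). Qed.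

Lemma cvg_gs0 (a : T -> 'I_n -> R) (la : 'I_n -> R) k : 0 < dot la la ->
  (forall i, a x i @[x --> F] --> la i) -> gs0 (a x) k @[x --> F] --> gs0 la k.
Proof.
move=> aa0 ha; apply: cvg_div => //; first by rewrite gt_eqF ?sqrtr_gt0.
by apply: cvg_sqrt; exact: cvg_dot.
Qed.

Lemma cvg_gs1 (a b : T -> 'I_n -> R) (la lb : 'I_n -> R) k : 0 < dot la la -> 0 < gram la lb ->
  (forall i, a x i @[x --> F] --> la i) -> (forall i, b x i @[x --> F] --> lb i) ->
  gs1 (a x) (b x) k @[x --> F] --> gs1 la lb k.
Proof.
move=> aa0 g0 ha hb; apply: cvg_div; first by rewrite gt_eqF ?sqrtr_gt0 ?mulr_gt0.
  by apply: cvgB; apply: cvgM => //; exact: cvg_dot.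
by apply: cvg_sqrt; apply: cvgM; [exact: cvg_dot|exact: cvg_gram].
Qed.

End Continuity.

Section FrameContinuity.
Context (R : realType) (n : nat) (o0 o1 o2 : 'I_n).
Hypotheses (o01 : o0 != o1) (o02 : o0 != o2) (o12 : o1 != o2).
Variable r : pairs n -> R.
Hypotheses (r0 : forall I, 0 < r I) (rG : real_sGr2 r).
Context (F : set_system (pairs n -> R)) (FF : Filter F).
Hypothesis cvg_coord : forall I, x I @[x --> F] --> r I.

Lemma cvg_sym_ext i j : sym_ext x i j @[x --> F] --> sym_ext r i j.
Proof.
rewrite /sym_ext; case: (insub (i, j) : option (pairs n)) => [J|]; first exact: cvg_coord.
case: (insub (j, i) : option (pairs n)) => [J|]; first exact: cvg_coord.
exact: cvg_cst.
Qed.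

Lemma cvg_row0 k :
  row0 o0 x k @[x --> F] --> row0 o0 r k.
Proof.
rewrite /row0; case: eqP => _; first exact: (cvg_cst (0 : R)).
by apply: cvg_sqrt; exact: cvg_sym_ext.
Qed.

Lemma cvg_row1 k :
  row1 o0 o1 o2 x k @[x --> F] --> row1 o0 o1 o2 r k.
Proof.
rewrite /row1; case: eqVneq => [_|k0]; first by apply: cvg_sqrt; exact: cvg_sym_ext.
apply: cvg_div.
- by rewrite mulf_neq0// gt_eqF// sqrtr_gt0 ?mulr_gt0// sym_ext_gt0// eq_sym.
- apply: cvgM; last exact: (cvg_cst (2^-1 : R)).
  by apply: cvgB; [apply: cvgD|]; apply: cvgM; exact: cvg_sym_ext.
- by apply: cvgM; apply: cvg_sqrt; [apply: cvgM|]; exact: cvg_sym_ext.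
Qed.

Lemma cvg_frame0 k :
  frame0 o0 x k @[x --> F] --> frame0 o0 r k.
Proof. apply: cvg_gs0 => [|i]; [exact: (dot_row0_gt0 o01)|exact: cvg_row0]. Qed.

Lemma cvg_frame1 k :
  frame1 o0 o1 o2 x k @[x --> F] --> frame1 o0 o1 o2 r k.
Proof.
apply: cvg_gs1 => [||i|i]; [exact: (dot_row0_gt0 o01)|exact: gram_row_gt0|
  exact: cvg_row0|exact: cvg_row1].
Qed.

End FrameContinuity.

(** * The tangent inequality for log sin *)

Section Trig.
Context (R : realType).

Lemma near_cos_sin_gt0 (k : R) : \forall d \near (0 : R), 0 < cos d + k * sin d.
Proof.
have h : cos d + k * sin d @[d --> (0 : R)] --> cos 0 + k * sin 0.
  by apply: cvgD; [exact: continuous_cos|apply: cvgMl_tmp; exact: continuous_sin].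
by apply: (cvgr_gt _ h); rewrite cos0 sin0 mulr0 addr0 ltr01.
Qed.

(** The derivative of the difference is
    [sin d + k (1 - cos d) = 2 sin (d/2) (cos (d/2) + k sin (d/2))], which is
    nonnegative for small [d >= 0]. *)
Lemma trig_tangent_right (k : R) : exists2 e : R, 0 < e &
  forall d, 0 <= d < e -> cos d + k * sin d <= 1 + k * d.
Proof.
have /nbhs_ballP[e /= e0 he] := near_cos_sin_gt0 k.
exists (Num.min e pi); first by rewrite lt_min e0 pi_gt0.
move=> d /andP[d0]; rewrite lt_min => /andP[de dpi].
pose f x : R := 1 + k * x - (cos x + k * sin x).
pose df x : R := k - (- sin x + k * cos x).
have fd (x : R) : is_derive x (1 : R) f (df x).
  rewrite /f /df.
  have -> : (fun x : R => 1 + k * x - (cos x + k * sin x)) =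
    cst 1 + k \*: id - (cos + k \*: (@sin R)) by [].
  by apply: is_derive_eq; rewrite add0r /GRing.scale /= mulr1.
have cf : {within `[0, d], continuous f}.
  apply: continuous_subspaceT => x; apply: differentiable_continuous.
  by apply/derivable1_diffP; have [] := fd x.
have [c] := MVT_segment d0 (fun x _ => fd x) cf.
rewrite in_itv /= => /andP[c0 cd] fE.
have : 0 <= f d - f 0.
  rewrite fE mulr_ge0 ?subr0 // /df.
  have -> : k - (- sin c + k * cos c) = 2 * sin (c / 2) * (cos (c / 2) + k * sin (c / 2)).
    have -> : c = (c / 2) *+ 2 by rewrite -mulr_natr divfK.
    rewrite sin_mulr2n cos_mulr2n -[(c / 2) *+ 2]mulr_natr mulfK// cos2sin2; ring.
  apply: mulr_ge0.
    by rewrite mulr_ge0// sin_ge0_pi// divr_ge0//= ler_pdivrMr//; lra.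
  apply/ltW/he; rewrite /ball /= sub0r normrN ger0_norm ?divr_ge0//.
  by rewrite ltr_pdivrMr//; lra.
by rewrite /f cos0 sin0 !mulr0 !addr0 subrr subr0 subr_ge0.
Qed.

(** With [k = cot t], the middle term is [sin (t + d) / sin t]: this is the bound
    of [log sin] by its tangent at [t]. *)
Lemma trig_tangent (k : R) : \forall d \near (0 : R),
  0 < cos d + k * sin d <= expR (k * d).
Proof.
have [e1 e10 h1] := trig_tangent_right k.
have [e2 e20 h2] := trig_tangent_right (- k).
near=> d; apply/andP; split; first by near: d; exact: near_cos_sin_gt0.
apply: le_trans (expR_ge1Dx _); have [d0|d0] := leP 0 d.
  by apply: h1; rewrite d0 /= -[d]ger0_norm//; near: d; exact: nbhs0_lt.
have := h2 (- d); rewrite cosN sinN !mulrNN; apply.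
by rewrite oppr_ge0 ltW//= -ltr0_norm//; near: d; exact: nbhs0_lt.
Unshelve. all: by end_near. Qed.
End Trig.

(** * Lengths and angles of the columns *)

Section PolarComparison.
Context (R : realType) (n : nat).
Implicit Types a b : 'I_n -> R.

Definition norm2 a b k : R := a k ^+ 2 + b k ^+ 2.

(** [rot_cos] and [rot_sin] are the cosine and the sine of the angle from the
    column [k] of the matrix with rows [a'], [b'] to that of the matrix with
    rows [a], [b], both multiplied by the product of the two lengths. *)
Definition rot_cos a' b' a b k : R := a' k * a k + b' k * b k.

Definition rot_sin a' b' a b k : R := a' k * b k - b' k * a k.

Definition rot_angle a' b' a b k : R := atan (rot_sin a' b' a b k / rot_cos a' b' a b k).

(** The cotangent of the angle between the columns [i] and [j]. *)
Definition cot a b (i j : 'I_n) : R := (a i * a j + b i * b j) / cross a b i j.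

(** [p_ij = rho_i rho_j sin (theta_j - theta_i)], and
    [sin (t + d) = sin t (cos d + cot t * sin d)]. *)
Lemma cross2_polar a' b' a b i j : 0 < rot_cos a' b' a b i -> 0 < rot_cos a' b' a b j ->
  cross a' b' i j != 0 ->
  let d := rot_angle a' b' a b j - rot_angle a' b' a b i in
  cross a b i j ^+ 2 = cross a' b' i j ^+ 2 *
   (norm2 a b i / norm2 a' b' i * (norm2 a b j / norm2 a' b' j) *
    (cos d + cot a' b' i j * sin d) ^+ 2).
Proof.
move=> Ci0 Cj0 p0 d.
have NC k : 0 < rot_cos a' b' a b k -> norm2 a' b' k != 0.
  apply: contraTneq => /eqP; rewrite /norm2 paddr_eq0 ?sqr_ge0// !sqrf_eq0.
  by move=> /andP[/eqP ak /eqP bk]; rewrite /rot_cos ak bk !mul0r addr0 ltxx.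
have Ni := NC _ Ci0; have Nj := NC _ Cj0.
have ang k : 0 < rot_cos a' b' a b k -> exists s, exists c,
  [/\ sin (rot_angle a' b' a b k) = s, cos (rot_angle a' b' a b k) = c,
   s * rot_cos a' b' a b k = c * rot_sin a' b' a b k &
   c ^+ 2 * (norm2 a b k * norm2 a' b' k) = rot_cos a' b' a b k ^+ 2].
  move=> C0; set t := rot_angle a' b' a b k; exists (sin t), (cos t).
  have c0 : cos t != 0 by rewrite gt_eqF// cos_gt0_pihalf// atan_gtNpi2 atan_ltpi2.
  have st : sin t * rot_cos a' b' a b k = cos t * rot_sin a' b' a b k.
    have : tan t = rot_sin a' b' a b k / rot_cos a' b' a b k by rewrite atanK.
    rewrite /tan => /(congr1 (fun y => y * cos t * rot_cos a' b' a b k)).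
    rewrite divfK// => ->; field; by rewrite gt_eqF.
  split=> //; have -> : norm2 a b k * norm2 a' b' k =
     rot_cos a' b' a b k ^+ 2 + rot_sin a' b' a b k ^+ 2.
    by rewrite /norm2 /rot_cos /rot_sin; ring.
  by rewrite mulrDr -[in X in _ + X]exprMn -st exprMn -mulrDl cos2Dsin2 mul1r.
rewrite /d sinB cosB.
have [si [ci [-> -> sci nci]]] := ang _ Ci0.
have [sj [cj [-> -> scj ncj]]] := ang _ Cj0.
set y := _ + cot a' b' i j * _.
have yE : y * (rot_cos a' b' a b i * rot_cos a' b' a b j * cross a' b' i j) =
    ci * cj * (norm2 a' b' i * norm2 a' b' j) * cross a b i j.
  transitivity ((cj * rot_cos a' b' a b j * (ci * rot_cos a' b' a b i) +
     sj * rot_cos a' b' a b j * (si * rot_cos a' b' a b i)) * cross a' b' i j +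
     (sj * rot_cos a' b' a b j * (ci * rot_cos a' b' a b i) -
     cj * rot_cos a' b' a b j * (si * rot_cos a' b' a b i)) *
       (a' i * a' j + b' i * b' j)).
    by rewrite /y /cot; field.
  by rewrite sci scj /rot_cos /rot_sin /cross /norm2; ring.
have : y ^+ 2 * (ci ^+ 2 * (norm2 a b i * norm2 a' b' i) *
      (cj ^+ 2 * (norm2 a b j * norm2 a' b' j)) * cross a' b' i j ^+ 2) =
   ci ^+ 2 * cj ^+ 2 * (norm2 a' b' i * norm2 a' b' j) ^+ 2 * cross a b i j ^+ 2.
  by rewrite nci ncj -!exprMn yE !exprMn.
have ci0 : ci != 0.
  by apply: contraTneq Ci0 => ci0; move: nci; rewrite ci0 expr0n mul0r => /esym/eqP;
     rewrite sqrf_eq0 => /eqP ->; rewrite ltxx.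
have cj0 : cj != 0.
  by apply: contraTneq Cj0 => cj0; move: ncj; rewrite cj0 expr0n mul0r => /esym/eqP;
     rewrite sqrf_eq0 => /eqP ->; rewrite ltxx.
move=> e.
have cc : ci ^+ 2 * cj ^+ 2 * (norm2 a' b' i * norm2 a' b' j) ^+ 2 != 0.
  by rewrite !mulf_neq0 ?expf_neq0 ?mulf_neq0.
apply: (mulfI cc); rewrite -e; field.
by rewrite Ni Nj.
Qed.

(** The logarithm of each factor of [cross2_polar] is bounded by its tangent:
    [ln g <= g - 1] for the squared lengths, and [trig_tangent] for the sine. *)
Lemma ln_cross2_le a' b' a b i j : 0 < rot_cos a' b' a b i -> 0 < rot_cos a' b' a b j ->
  cross a' b' i j != 0 -> cross a b i j != 0 ->
  let d := rot_angle a' b' a b j - rot_angle a' b' a b i in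
  0 < cos d + cot a' b' i j * sin d <= expR (cot a' b' i j * d) ->
  ln (cross a b i j ^+ 2) <= ln (cross a' b' i j ^+ 2) +
   ((norm2 a b i / norm2 a' b' i - 1) + (norm2 a b j / norm2 a' b' j - 1) +
    2 * (d * cot a' b' i j)).
Proof.
move=> Ci0 Cj0 p'0 p0 d /andP[y0 yexp].
have pp (a1 b1 : 'I_n -> R) : cross a1 b1 i j != 0 -> 0 < cross a1 b1 i j ^+ 2.
  by move=> c0; rewrite exprn_even_gt0.
rewrite -ler_expR expRD !lnK ?posrE ?pp// (cross2_polar Ci0 Cj0 p'0) -/d.
rewrite ler_pM2l ?pp// expRD [X in _ <= X * _]expRD.
have N0 (a1 b1 : 'I_n -> R) k : 0 <= norm2 a1 b1 k by rewrite addr_ge0 ?sqr_ge0.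
have g k : 0 <= norm2 a b k / norm2 a' b' k <= expR (norm2 a b k / norm2 a' b' k - 1).
  by rewrite divr_ge0//= (le_trans _ (expR_ge1Dx _))// addrC subrK.
have [/andP[gi0 gi] /andP[gj0 gj]] := (g i, g j).
apply: ler_pM => //; [exact: mulr_ge0|exact: sqr_ge0|exact: ler_pM|].
have -> : 2 * (d * cot a' b' i j) = cot a' b' i j * d * 2%:R by ring.
by rewrite expRM_natr ler_pXn2r ?nnegrE ?expR_ge0// ltW.
Qed.
End PolarComparison.

Lemma loglik_sum (R : realType) n (u : pairs n -> nat) (x : pairs n -> R) :
  (forall I, 0 < x I) -> 0 < \sum_J x J ->
  loglik u x = \sum_I (u I)%:R * ln (x I / \sum_J x J).
Proof.
move=> x0 s0; rewrite /loglik natr_sum mulr_suml -sumrB; apply: eq_bigr => I _.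
by rewrite ln_div ?posrE// mulrBr.
Qed.

Lemma cross_neq0 (F : idomainType) n (a b : 'I_n -> F) i j c y :
  y = c * cross a b i j ^+ 2 -> y != 0 -> cross a b i j != 0.
Proof. by move=> ->; apply: contra_neq => ->; rewrite expr0n mulr0. Qed.

(** * Local maximality *)

Section LocalMax.
Context (R : realType) (n : nat) (u : pairs n -> nat) (r : pairs n -> R).
Context (q : pairs n -> R[i]).
Hypotheses (crit : critical_point u q) (qr : proj_eq q (fun I => (r I)%:C%C)).
Context (a b : 'I_n -> R).
Hypotheses (aa : dot a a = 1) (ab : dot a b = 0) (bb : dot b b = 1).
Hypotheses (s0 : 0 < \sum_J r J) (n2 : (0 < #|{: pairs n}|)%N).
Hypothesis rE : forall I, r I / (\sum_J r J) = cross a b (val I).1 (val I).2 ^+ 2.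

(** For orthonormal rows the Gram determinant is 1 and [dual_form] is the
    scalar product of the columns. *)
Lemma critical_real (phi : 'I_n -> R) :
  \sum_I (u I)%:R * (phi (val I).1 + phi (val I).2) =
    (\sum_I u I)%N%:R * \sum_i phi i * norm2 a b i /\
  \sum_I (u I)%:R * ((phi (val I).2 - phi (val I).1) * cot a b (val I).1 (val I).2) = 0.
Proof.
have [c c0 qE] := qr.
pose Ca i := (a i)%:C%C; pose Cb i := (b i)%:C%C.
have crossE i j : cross Ca Cb i j = (cross a b i j)%:C%C.
  by rewrite /cross rmorphB !rmorphM.
have dotE (x y : 'I_n -> R) : dot (fun i => (x i)%:C%C) (fun i => (y i)%:C%C) = (dot x y)%:C%C.
  by rewrite /dot rmorph_sum; apply: eq_bigr => i _; rewrite rmorphM.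
have qE' I : q I = c * (\sum_J r J)%:C%C * cross Ca Cb (val I).1 (val I).2 ^+ 2.
  by rewrite qE crossE -mulrA -rmorphXn -rmorphM -rE mulrCA divff ?mulr1// gt_eqF.
have c0' : c * (\sum_J r J)%:C%C != 0 by rewrite mulf_neq0// fmorph_eq0 gt_eqF.
have aaC : dot Ca Ca = 1 by rewrite dotE aa.
have abC : dot Ca Cb = 0 by rewrite dotE ab.
have bbC : dot Cb Cb = 1 by rewrite dotE bb.
have formE i j : dual_form Ca Cb i j = (a i * a j + b i * b j)%:C%C.
  by rewrite /dual_form aaC abC bbC rmorphD !rmorphM; ring.
split; apply: complexI.
  have := critical_scale n2 crit c0' qE' (fun i => (phi i)%:C%C).
  rewrite /gram aaC abC bbC expr0n mulr1 subr0 divr1 => e.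
  rewrite rmorph_sum rmorphM rmorph_nat.
  transitivity (\sum_I (u I)%:R * ((phi (val I).1)%:C%C + (phi (val I).2)%:C%C)).
    by apply: eq_bigr => I _; rewrite rmorphM rmorph_nat rmorphD.
  rewrite e; congr (_ * _); rewrite rmorph_sum; apply: eq_bigr => i _.
  by rewrite formE -rmorphM /norm2 !expr2.
rewrite rmorph0 -[RHS](critical_rot n2 crit c0' qE' (fun i => (phi i)%:C%C)) rmorph_sum.
apply: eq_bigr => I _; rewrite formE crossE /cot.
by rewrite rmorphM rmorph_nat; congr (_ * _); rewrite rmorphM rmorphB fmorph_div mulrA.
Qed.

(** The tangent bounds are summed with the weights [u]. The angle terms give the
    rotation equation with [phi = rot_angle]. By the rescaling equation the
    length terms give a multiple of the difference of the two sums of squared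
    lengths, which are both equal to 2. *)
Lemma loglik_le (x : pairs n -> R) (a' b' : 'I_n -> R) :
  (forall I, 0 < r I) -> (forall I, 0 < x I) -> 0 < \sum_J x J ->
  dot a' a' = 1 -> dot b' b' = 1 ->
  (forall I, x I / (\sum_J x J) = cross a' b' (val I).1 (val I).2 ^+ 2) ->
  (forall k, 0 < rot_cos a b a' b' k) ->
  (forall I : pairs n, let i := (val I).1 in let j := (val I).2 in
    let d := rot_angle a b a' b' j - rot_angle a b a' b' i in
    0 < cos d + cot a b i j * sin d <= expR (cot a b i j * d)) ->
  loglik u x <= loglik u r.
Proof.
move=> r0 x0 sx0 aa' bb' xE C0 hd.
rewrite !loglik_sum//; under eq_bigr do rewrite xE.
under [leRHS]eq_bigr do rewrite rE.
pose g k := norm2 a' b' k / norm2 a b k - 1.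
pose t k := rot_angle a b a' b' k.
apply: (@le_trans _ _ (\sum_I (u I)%:R * (ln (cross a b (val I).1 (val I).2 ^+ 2) +
   (g (val I).1 + g (val I).2 + 2 * ((t (val I).2 - t (val I).1) *
     cot a b (val I).1 (val I).2))))).
  apply: ler_sum => I _; rewrite ler_wpM2l//; apply: ln_cross2_le => //.
    apply: (@cross_neq0 _ _ _ _ _ _ 1 (r I / \sum_J r J)); first by rewrite rE mul1r.
    by rewrite gt_eqF// divr_gt0.
  apply: (@cross_neq0 _ _ _ _ _ _ 1 (x I / \sum_J x J)); first by rewrite xE mul1r.
  by rewrite gt_eqF// divr_gt0.
have [scale _] := critical_real g; have [_ rot] := critical_real t.
have -> : \sum_I (u I)%:R * (ln (cross a b (val I).1 (val I).2 ^+ 2) +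
   (g (val I).1 + g (val I).2 + 2 * ((t (val I).2 - t (val I).1) *
     cot a b (val I).1 (val I).2))) =
  \sum_I (u I)%:R * ln (cross a b (val I).1 (val I).2 ^+ 2) +
  \sum_I (u I)%:R * (g (val I).1 + g (val I).2) +
  2 * \sum_I (u I)%:R * ((t (val I).2 - t (val I).1) * cot a b (val I).1 (val I).2).
  by rewrite mulr_sumr -!big_split; apply: eq_bigr => I _ /=; ring.
rewrite rot mulr0 addr0 scale.
suff -> : \sum_i g i * norm2 a b i = 0 by rewrite mulr0 addr0.
have N0 k : norm2 a b k != 0.
  apply: contraTneq (C0 k) => /eqP; rewrite /norm2 paddr_eq0 ?sqr_ge0// !sqrf_eq0.
  by move=> /andP[/eqP ak /eqP bk]; rewrite /rot_cos ak bk !mul0r addr0 ltxx.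
have sN (x1 y1 : 'I_n -> R) : \sum_i norm2 x1 y1 i = dot x1 x1 + dot y1 y1.
  by rewrite -big_split; apply: eq_bigr => i _; rewrite /norm2 !expr2.
transitivity (\sum_i (norm2 a' b' i - norm2 a b i)).
  by apply: eq_bigr => i _; rewrite /g mulrBl divfK// mul1r.
by rewrite sumrB !sN aa' bb' aa bb subrr.
Qed.
End LocalMax.

(** As the frame is continuous, its columns at a nearby point make small
    angles with those at [r], within reach of the tangent bounds. *)
Lemma critical_local_max (R : realType) n (u : pairs n -> nat) (r : pairs n -> R)
  (q : pairs n -> R[i]) : (3 <= n)%N -> critical_point u q ->
  proj_eq q (fun I => (r I)%:C%C) -> (forall I, 0 < r I) -> loglik_local_max u r.
Proof.
move=> n3 crit qr r0.
pose o0 := Ordinal (ltnW (ltnW n3)); pose o1 := Ordinal (ltnW n3); pose o2 := Ordinal n3.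
have o01 : o0 != o1 by []. have o02 : o0 != o2 by []. have o12 : o1 != o2 by [].
have [I0 _] := pair_of o01.
have n2 : (0 < #|{: pairs n}|)%N by apply/card_gt0P; exists I0.
have rG : real_sGr2 r.
  have [c c0 qE] := qr; have [/sGr2_cross[c' [a [b [c'0 qE']]]] _] := crit.1.
  apply: (@cross_sGr2 _ _ _ (c' / c) a b I0); first by rewrite mulf_neq0 ?invr_neq0.
    by move=> I; apply: (mulfI c0); rewrite -qE qE'; field.
  by rewrite fmorph_eq0 gt_eqF.
split=> //.
have [aa ab bb rE] := frame_spec o01 o02 o12 r0 rG.
have s0 := sum_coord_gt0 o01 r0.
set a := frame0 o0 r in aa ab rE; set b := frame1 o0 o1 o2 r in ab bb rE.
have N0 k : 0 < norm2 a b k.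
  have [j kj] : exists j, k != j.
    by have [->|] := eqVneq k o1; [exists o0|exists o1].
  rewrite lt_neqAle addr_ge0 ?sqr_ge0// andbT eq_sym paddr_eq0 ?sqr_ge0// !sqrf_eq0.
  apply/negP => /andP[/eqP ak /eqP bk]; have [I Ik] := pair_of kj.
  have : cross a b (val I).1 (val I).2 != 0.
    apply: (@cross_neq0 _ _ _ _ _ _ 1 (r I / \sum_J r J)); first by rewrite rE mul1r.
    by rewrite gt_eqF// divr_gt0.
  by case: Ik => -> /=; rewrite /cross ak bk !(mulr0, mul0r) subrr eqxx.
pose F : set_system (pairs n -> R) := nbhs (r : {ptws pairs n -> R}).
have FF : Filter F := @nbhs_filter {ptws pairs n -> R} r.
have hF I : x I @[x --> F] --> r I.
  have h : x I @[x --> (r : {ptws pairs n -> R})] --> r I.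
    exact: (@proj_continuous _ (fun _ => R) I r).
  exact: h.
have ca k : frame0 o0 x k @[x --> F] --> a k by exact: (cvg_frame0 o01 r0 FF hF).
have cb k : frame1 o0 o1 o2 x k @[x --> F] --> b k.
  exact: (cvg_frame1 o01 o02 o12 r0 rG FF hF).
have cC k : rot_cos a b (frame0 o0 x) (frame1 o0 o1 o2 x) k
    @[x --> F] --> norm2 a b k.
  by rewrite /norm2 !expr2; apply: cvgD; apply: cvgMl_tmp.
have cS k : rot_sin a b (frame0 o0 x) (frame1 o0 o1 o2 x) k
    @[x --> F] --> (0 : R).
  have -> : 0 = a k * b k - b k * a k by ring.
  by apply: cvgB; apply: cvgMl_tmp.
have ct k : rot_angle a b (frame0 o0 x) (frame1 o0 o1 o2 x) k
    @[x --> F] --> (0 : R).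
  have := cvg_div FF (lt0r_neq0 (N0 k)) (cS k) (cC k).
  rewrite mul0r => h; rewrite -[X in _ --> X]atan0.
  exact: (cvg_comp _ _ h (@continuous_atan R 0)).
rewrite -/F; near=> x => xG.
have x0 : forall I, 0 < x I.
  near: x; apply: filter_forall => I.
  by apply: (cvgr_gt (r I)); [exact: hF|exact: r0].
have [xaa _ xbb xE] := frame_spec o01 o02 o12 x0 xG.
apply: (loglik_le crit qr aa ab bb s0 n2 rE r0 x0 (sum_coord_gt0 o01 x0) xaa xbb xE).
  near: x; apply: filter_forall => k.
  by apply: (cvgr_gt (norm2 a b k)); [exact: cC|exact: N0].
near: x; apply: filter_forall => I.
have cd : rot_angle a b (frame0 o0 x) (frame1 o0 o1 o2 x) (val I).2 -
    rot_angle a b (frame0 o0 x) (frame1 o0 o1 o2 x) (val I).1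
    @[x --> F] --> (0 : R).
  by rewrite -[X in _ --> X](subrr 0); apply: cvgB.
exact: (cd _ (trig_tangent (cot a b (val I).1 (val I).2))).
Unshelve. all: by end_near. Qed.

Theorem theorem1p3 (R : realType) (n : nat) (u : pairs n -> nat)
    (q : pairs n -> R[i]) (hn : (3 <= n)%N) (hu : forall I, (0 < u I)%N)
    (hq : critical_point u q) :
  exists r : pairs n -> R,
    [/\ forall I, 0 < r I,
        proj_eq q (fun I => (r I)%:C%C)
      & loglik_local_max u r].
Proof.
have [c [z [c0 zz qE]]] := critical_positive (ltnW hn) hu hq.
pose e (I : pairs n) : R[i] := (degree u (val I).1 * degree u (val I).2)%:R *
  `|z (val I).1 - z (val I).2| ^+ 2.
have e0 I : 0 < e I.
  rewrite mulr_gt0 ?exprn_gt0 ?normr_gt0 ?subr_eq0//.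
  by rewrite ltr0n muln_gt0 !degree_gt0 // ltnW.
have eE I : e I = (complex.Re (e I))%:C%C by rewrite RRe_real// ger0_real// ltW.
have r0 I : 0 < complex.Re (e I) by rewrite -ltcR -eE.
have qr : proj_eq q (fun I => (complex.Re (e I))%:C%C).
  by exists c => // I; rewrite -eE qE.
by exists (fun I => complex.Re (e I)); split=> //; exact: critical_local_max hq qr r0.
Qed.
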